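(* Let $T$ be a tree of order $n$. Then $$W(T)\leq \frac{1}{4}\,(2n-3)\,\varepsilon(T) + \frac{1}{4},$$ with equality holding if and only if $T$ is the star $K_{1,n-1}$.
   Context: Graphs are finite and simple; the order is the number of vertices. $d_T(u,v)$ is the number of edges on the $u,v$-path. The Wiener index is $W(T)=\sum_{\{u,v\}\subseteq V(T)} d_T(u,v)$ (sum over unordered pairs of vertices). The eccentricity of a vertex $v$ is $\varepsilon_T(v)=\max_{u\in V(T)} d_T(v,u)$, and the eccentricity of the tree is $\varepsilon(T)=\sum_{v\in V(T)}\varepsilon_T(v)$. $K_{1,m}$ is the star of order $m+1$.
   Formalization: The inequality is stated for n ≠ 2 and the equality characterization for n ≥ 3: for n = 2 (K_{1,1}) W = 1 exceeds the bound 3/4, and for n = 1 (K_{1,0}) W = 0 while the bound is 1/4, so the claims fail there. *)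

(* Defs.v *)
From HB Require Import structures.
From mathcomp Require Import all_boot all_order all_algebra.

Set Implicit Arguments.
Unset Strict Implicit.
Unset Printing Implicit Defensive.

Record sgraph := SGraph {
  vertex :> finType;
  edge : rel vertex;
  edge_sym : symmetric edge;
  edge_irrefl : irreflexive edge
}.

Definition connected (G : sgraph) : Prop :=
  forall u v : G, connect (@edge G) u v.

Definition acyclic (G : sgraph) : Prop :=
  forall c : seq G, uniq c -> cycle (@edge G) c -> size c <= 2.

Definition is_tree (G : sgraph) : Prop :=
  [/\ 0 < #|G|, connected G & acyclic G].

(* [u :: p] is a path in the graph-theoretic sense: no repeated vertex.
   It has [size p] edges. *)
Definition is_path (G : sgraph) (u v : G) (p : seq G) : bool :=
  [&& path (@edge G) u p, last u p == v & uniq (u :: p)].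

(* The number of edges on a u,v-path, or 0 if there is none. In a tree the
   u,v-path exists and is unique, so the value does not depend on [pick].
   Having distinct vertices, a path has fewer than #|G| edges. *)
Definition dist (G : sgraph) (u v : G) : nat :=
  if [pick m : 'I_#|G| | [exists p : m.-tuple G, is_path u v p]] is Some m
  then m else 0.

(* Each unordered pair of distinct vertices is counted once, through its
   orientation that is increasing in the enumeration of the vertices. *)
Definition wiener (G : sgraph) : nat :=
  \sum_(u : G) \sum_(v : G | enum_rank u < enum_rank v) dist u v.

Definition vertex_ecc (G : sgraph) (v : G) : nat := \max_(u : G) dist v u.

Definition total_ecc (G : sgraph) : nat := \sum_(v : G) vertex_ecc v.

(* K_{1,m}: the centre is [None], the leaves are the [Some i]. *)
Definition star_edge (m : nat) : rel (option 'I_m) :=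
  fun x y => isSome x != isSome y.

Lemma star_edge_sym (m : nat) : symmetric (@star_edge m).
Proof. by move=> x y; rewrite /star_edge eq_sym. Qed.

Lemma star_edge_irrefl (m : nat) : irreflexive (@star_edge m).
Proof. by move=> x; rewrite /star_edge eqxx. Qed.

Definition star (m : nat) : sgraph :=
  SGraph (@star_edge_sym m) (@star_edge_irrefl m).

Definition isomorphic (G H : sgraph) : Prop :=
  exists2 f : G -> H, bijective f & forall u v : G, edge (f u) (f v) = edge u v.

(* Main.v *)
(** Along a longest path from [v], whose vertices are at distances
    [0, 1, ..., e] from [v] where [e] is the eccentricity of [v], one gains
    [sum_u (e - d(v,u)) >= e (e + 1) / 2]. Hence twice the transmission
    [sum_u d(v,u)] is at most [(2 n - 3) e + e (2 - e)], and [e (2 - e)] is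
    positive only for [e = 1], where it equals 1. As soon as [n >= 3], a tree
    has at most one vertex of eccentricity 1, and it has one exactly when it is
    a star. *)

Require Import Defs.
From HB Require Import structures.
From mathcomp Require Import all_boot all_order all_algebra.
From mathcomp Require Import zify lra.

Set Implicit Arguments.
Unset Strict Implicit.
Unset Printing Implicit Defensive.

(** * Paths and distances in trees *)

Lemma acyclic_path_uniq (G : sgraph) (u v : G) (p q : seq G) :
  acyclic G -> is_path u v p -> is_path u v q -> p = q.
Proof.
move=> acG; elim: p u q => [|x p IHp] u [|y q] //.
- case/and3P=> _ /eqP/= <- _ /and3P[_ /eqP/= uq /andP[/negP[]]].
  by rewrite -{1}uq mem_last.
- case/and3P=> _ /eqP/= uq /andP[/negP uNp _] /and3P[_ /eqP/= uv _].
  by case: uNp; rewrite uv -uq mem_last.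
rewrite /is_path /= => /and3P[/andP[ux xp] /eqP lp /andP[uNp Up]].
case/and3P=> /andP[uy yq] /eqP lq /andP[uNq Uq].
have [exy|nxy] := eqVneq x y.
  rewrite -exy in yq lq Uq *; congr (_ :: _).
  by apply: (IHp x); apply/and3P; split=> //; apply/eqP.
(* Both tails avoid [u], so they join [x] to [y] in the graph minus [u];
   together with [u] this closes a cycle. *)
pose e := [rel a b : G | [&& edge a b, a != u & b != u]].
have e_path z r : path (@edge G) z r -> u \notin z :: r -> path e z r.
  elim: r z => //= a r IHr z /andP[za ar].
  rewrite !inE !negb_or => /and3P[uz ua ur].
  by rewrite za ![_ == u]eq_sym uz ua IHr // inE negb_or ua.
have e_sym : connect_sym e.
  by apply: sym_connect_sym => a b /=; rewrite edge_sym [X in _ && X]andbC.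
have xv : connect e x v.
  by apply/connectP; exists p => //; apply: e_path.
have yv : connect e y v.
  by apply/connectP; exists q => //; apply: e_path.
have := connect_trans xv; rewrite e_sym in yv => /(_ _ yv) /connectP[r].
case/shortenP=> s es Us _ ly.
have us : u \notin x :: s.
  rewrite inE negb_or; apply/andP; split.
    by move: uNp; rewrite inE negb_or => /andP[].
  elim: s x es {Us ly nxy xp lp uNp Up ux xv} => //= a s IHs z /andP[].
  by case/and3P=> _ _ au /IHs; rewrite inE negb_or eq_sym au.
have := acG (u :: x :: s); rewrite cons_uniq us Us => /(_ isT).
have -> : cycle (@edge G) [:: u, x & s].
  rewrite /= ux rcons_path -ly edge_sym uy andbT.
  by apply: sub_path es => a b /and3P[].
(* Acyclicity allows this cycle at most two vertices, so [s] is empty and [y = x], a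
   contradiction. *)
move=> /(_ isT); case: s ly {es Us us} => // yx.
by rewrite yx eqxx in nxy.
Qed.

Lemma dist_is_path (G : sgraph) (u v : G) (p : seq G) :
  acyclic G -> is_path u v p -> dist u v = size p.
Proof.
move=> acG puv; rewrite /dist; case: pickP => [m /existsP[q quv]|no_path].
  by rewrite (acyclic_path_uniq acG puv quv) size_tuple.
have sp : size p < #|G|.
  by case/and3P: puv => _ _ /card_uniqP cp; rewrite -[leqLHS]cp max_card.
by have /existsP[] := no_path (Ordinal sp); exists (in_tuple p).
Qed.

Lemma connected_is_path (G : sgraph) (u v : G) :
  connected G -> exists p, is_path u v p.
Proof.
move=> /(_ u v) /connectP[p].
by case/shortenP=> q uq Uq _ ->; exists q; rewrite /is_path uq eqxx.
Qed.

Section Tree.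

Variables (T : sgraph) (T_tree : is_tree T).

Let conT : connected T. Proof. by case: T_tree. Qed.
Let acT : acyclic T. Proof. by case: T_tree. Qed.

Lemma dist_refl (v : T) : dist v v = 0.
Proof. by rewrite (@dist_is_path _ v v [::]) // /is_path /= eqxx. Qed.

Lemma dist_edge (u v : T) : edge u v -> dist u v = 1.
Proof.
move=> uv; rewrite (@dist_is_path _ u v [:: v]) // /is_path /= uv eqxx inE.
by case: eqP uv => // ->; rewrite edge_irrefl.
Qed.

Lemma dist_sym (u v : T) : dist u v = dist v u.
Proof.
have [p puv] := connected_is_path u v conT.
rewrite (dist_is_path acT puv); case/and3P: puv => up /eqP lp Up.
rewrite (@dist_is_path _ v u (rev (belast u p))) // ?size_rev ?size_belast //.
apply/and3P; split.
- by rewrite -lp rev_path (eq_path (e' := @edge T)) // => a b; rewrite edge_sym.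
- by case: p {up Up} lp => [|x p] /= lp; rewrite ?rev_cons ?last_rcons ?lp.
by rewrite -lp -rev_rcons -lastI rev_uniq.
Qed.

Lemma dist_le1_edge (u v : T) : u != v -> dist u v <= 1 -> edge u v.
Proof.
have [p puv] := connected_is_path u v conT.
rewrite (dist_is_path acT puv) => nuv.
case/and3P: puv nuv => + /eqP <- _.
by case: p => [|x [|y p]] //=; rewrite ?eqxx // andbT.
Qed.

(** A prefix of a path is again a path, hence the path to its own last vertex. *)
Lemma dist_nth_path (u v : T) (p : seq T) (i : nat) :
  is_path u v p -> i <= size p -> dist u (nth u (u :: p) i) = i.
Proof.
move=> /and3P[up _ Up] ip.
have sz : size (take i p) = i by rewrite size_take_min; apply/minn_idPl.
rewrite -{2}sz; apply: dist_is_path => //; apply/and3P; split.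
- exact: take_path.
- apply/eqP; case: i ip {sz} => [|i] ip; first by rewrite take0.
  rewrite (last_nth u) size_takel //=.
  by rewrite nth_take.
by move: Up; rewrite -[u :: take i p]/(take i.+1 (u :: p)); apply: take_uniq.
Qed.

(** * Transmissions and the Wiener index *)

Lemma dist_le_ecc (v u : T) : dist v u <= vertex_ecc v.
Proof. exact: leq_bigmax. Qed.

(** The form is additive and doubled to avoid subtraction and halves in [nat]. *)
Lemma transmission_le (v : T) :
  2 * (\sum_(u : T) dist v u) + vertex_ecc v * (vertex_ecc v).+1
    <= 2 * #|T| * vertex_ecc v.
Proof.
set e := vertex_ecc v.
have [w dw] : {w | e = dist v w}.
  by apply: eq_bigmax; apply/card_gt0P; exists v.
have [p pvw] := connected_is_path v w conT.
have pe : size p = e by rewrite dw (dist_is_path acT pvw).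
have gap : \sum_(u : T) (e - dist v u) + \sum_(u : T) dist v u = #|T| * e.
  rewrite -big_split /= -sum_nat_const; apply: eq_bigr => u _.
  by rewrite subnK ?dist_le_ecc.
have on_path : \sum_(u <- v :: p) (e - dist v u) = \sum_(i < e.+1) i.
  (* The vertex at position [i] has gap [e - i]; reversing the index turns this into [i]. *)
  rewrite (big_nth v) big_mkord /= pe [RHS](reindex_inj rev_ord_inj) /=.
  apply: eq_bigr => i _; rewrite subSS (dist_nth_path pvw) //.
  by rewrite pe -ltnS ltn_ord.
have : \sum_(u <- v :: p) (e - dist v u) <= \sum_(u : T) (e - dist v u).
  case/and3P: pvw => _ _ Up; rewrite big_uniq // [leqRHS](bigID [in v :: p]) /=.
  exact: leq_addr.
rewrite on_path => le_gap.
have gauss : 2 * \sum_(i < e.+1) i = e * e.+1.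
  elim: (e) => [|k IHk]; rewrite big_ord_recr /= ?big_ord0 //.
  by rewrite mulnDr IHk; lia.
nia.
Qed.

(** Each unordered pair is counted from both of its ends, and the diagonal contributes 0. *)
Lemma double_wiener : 2 * wiener T = \sum_(v : T) \sum_(u : T) dist v u.
Proof.
have swap : wiener T =
    \sum_(u : T) \sum_(v : T | enum_rank v < enum_rank u) dist u v.
  rewrite /wiener (exchange_big_dep xpredT) //=.
  by apply: eq_bigr => u _; apply: eq_bigr => v _; exact: dist_sym.
rewrite mul2n -addnn {2}swap -big_split /=; apply: eq_bigr => u _.
rewrite [RHS](bigID (fun v => enum_rank u < enum_rank v)) /=; congr (_ + _).
rewrite [RHS](bigD1 u) ?ltnn //= dist_refl add0n; apply: eq_bigl => v.
rewrite -leqNgt [RHS]andbC ltn_neqAle; congr (_ && _).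
by rewrite (inj_eq val_inj) (inj_eq enum_rank_inj).
Qed.

(** * Vertices adjacent to all others *)

Definition dominating (v : T) := forall u : T, u != v -> edge v u.

Lemma ecc1_dominating (v : T) : vertex_ecc v = 1 -> dominating v.
Proof.
move=> e1 u uv; apply: dist_le1_edge; first by rewrite eq_sym.
by rewrite -e1 dist_le_ecc.
Qed.

Lemma no_triangle (u v w : T) : edge u v -> edge v w -> ~~ edge w u.
Proof.
move=> uv vw; apply/negP => wu.
have neq (a b : T) : edge a b -> a != b.
  by apply: contraTneq => ->; rewrite edge_irrefl.
have := acT (c := [:: u; v; w]); rewrite /= !inE uv vw wu !negb_or neq //=.
by rewrite [u == w]eq_sym !neq // => /(_ isT isT).
Qed.

(** Two distinct dominating vertices are adjacent, so a third vertex would form a triangle with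
    them; only order 2 remains. *)
Lemma dominating_uniq (v w : T) :
  #|T| <> 2 -> dominating v -> dominating w -> v = w.
Proof.
move=> n2 dv dw; apply: contra_not_eq n2 => vw.
apply/eqP; rewrite -cardsT; have -> : [set: T] = [set v; w].
  apply/setP => x; rewrite !inE; apply/esym; apply: contraT.
  rewrite negb_or => /andP[xv xw].
  have vw_edge : edge v w by apply: dv; rewrite eq_sym.
  by have := no_triangle vw_edge (dw x xw); rewrite edge_sym dv.
by rewrite cards2 vw.
Qed.

Lemma sum_ecc1_le : #|T| <> 2 -> \sum_(v : T) (vertex_ecc v == 1) <= 1.
Proof.
move=> n2; case: (pickP (fun v : T => vertex_ecc v == 1)) => [v v1|no1].
  rewrite (bigD1 v) //= big1 ?addn0 ?leq_b1 // => w wv.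
  case: eqP => // w1; case/eqP: wv.
  by apply: dominating_uniq => //; apply: ecc1_dominating => //; apply/eqP.
by rewrite big1 // => v _; rewrite no1.
Qed.

Lemma wiener_le :
  4 * wiener T + 3 * total_ecc T
    <= 2 * #|T| * total_ecc T + \sum_(v : T) (vertex_ecc v == 1).
Proof.
rewrite -[4]/(2 * 2) -mulnA double_wiener /total_ecc !big_distrr /=.
rewrite -!big_split /=; apply: leq_sum => v _.
(* What remains is [3 * e <= e * e.+1 + (e == 1)], which is tight exactly for [e] equal to 0, 1 or
   2. *)
have := transmission_le v; case: (vertex_ecc v) => [|[|e]] /=; nia.
Qed.

(** * Stars and the equality case *)

Lemma dominating_dist (v u w : T) :
  dominating v -> u != v -> w != v -> u != w -> dist u w = 2.
Proof.
move=> dv uv wv uw; rewrite (@dist_is_path _ u w [:: v; w]) //.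
rewrite /is_path /= edge_sym !dv //= eqxx !inE negb_or uv uw /=.
by rewrite eq_sym wv.
Qed.

(** With [n = #|T|], the centre has eccentricity 1 and transmission [n - 1]; a leaf has eccentricity
    2 and transmission [2n - 3]. *)
Lemma dominating_transmission (v u : T) : 2 < #|T| -> dominating v ->
  2 * (\sum_(w : T) dist u w) + 3 * vertex_ecc u
    = 2 * #|T| * vertex_ecc u + (u == v).
Proof.
move=> n3 dv.
have sum1_eq (a : T) : \sum_(w : T) (w == a) = 1.
  by rewrite (bigD1 a) //= eqxx big1 // => w /negPf->.
(* A vertex other than [u] and [v] witnesses that the eccentricity of [u] is attained; order at
   least 3 provides it. *)
have [w] : exists w, w \in ~: [set u; v].
  by apply/card_gt0P; have := cardsC [set u; v]; rewrite cards2; lia.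
rewrite !inE negb_or => /andP[wu wv].
have [euv|uv] := eqVneq u v.
  have d1 x : dist u x + (x == u) = 1.
    have [->|xu] := eqVneq x u; first by rewrite dist_refl.
    by rewrite dist_edge // euv dv // -euv.
  have -> : vertex_ecc u = 1.
    apply/eqP; rewrite eqn_leq; apply/andP; split.
      by apply/bigmax_leqP => x _; rewrite -(d1 x) leq_addr.
    by apply: leq_trans (dist_le_ecc u w); have := d1 w; rewrite (negPf wu); lia.
  have : \sum_(x : T) (dist u x + (x == u)) = #|T|.
    by rewrite (eq_bigr _ (fun x _ => d1 x)) sum1_card.
  rewrite big_split /= sum1_eq; lia.
(* The indicators raise the distances 1 (at [v]) and 0 (at [u]) to the constant 2, which is then
   summed over the tree. *)
have d2 x : dist u x + (x == v) + ((x == u) + (x == u)) = 2.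
  have [->|xu] := eqVneq x u; first by rewrite dist_refl (negPf uv).
  have [->|xv] := eqVneq x v; first by rewrite dist_edge // edge_sym dv.
  by rewrite (dominating_dist dv uv xv) // eq_sym.
have -> : vertex_ecc u = 2.
  apply/eqP; rewrite eqn_leq; apply/andP; split.
    by apply/bigmax_leqP => x _; have := d2 x; lia.
  apply: leq_trans (dist_le_ecc u w).
  by have := d2 w; rewrite (negPf wu) (negPf wv); lia.
have : \sum_(x : T) (dist u x + (x == v) + ((x == u) + (x == u))) = #|T| * 2.
  by rewrite (eq_bigr _ (fun x _ => d2 x)) sum_nat_const.
rewrite !big_split /= !sum1_eq; lia.
Qed.

Lemma dominating_wiener (v : T) : 2 < #|T| -> dominating v ->
  4 * wiener T + 3 * total_ecc T = 2 * #|T| * total_ecc T + 1.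
Proof.
move=> n3 dv; have sum1 : \sum_(u : T) (u == v) = 1.
  by rewrite (bigD1 v) //= eqxx big1 // => u /negPf->.
rewrite -[4]/(2 * 2) -mulnA double_wiener /total_ecc.
rewrite -[X in _ = _ + X]sum1 !big_distrr /=.
rewrite -!big_split /=; apply: eq_bigr => u _.
exact: dominating_transmission.
Qed.

(** The vertex [v] becomes the centre and the others are numbered by rank, skipping that of [v]; two
    of them are never adjacent, as [v] would complete a triangle. *)
Lemma dominating_star (v : T) :
  dominating v -> isomorphic T (star #|T|.-1).
Proof.
move=> dv; exists (fun u => unlift (enum_rank v) (enum_rank u)).
  exists (fun o => if o is Some j then enum_val (lift (enum_rank v) j) else v).
    move=> u; case: unliftP => [j <-|/enum_rank_inj->] //.
    exact: enum_rankK.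
  by case=> [j|]; rewrite ?enum_valK ?liftK ?unlift_none.
(* Adjacency in the star depends only on [isSome], so it is enough to know which vertex goes to
   [None]. *)
have isSomeE u : isSome (unlift (enum_rank v) (enum_rank u)) = (u != v).
  case: unliftP => [j uj|/enum_rank_inj->]; last by rewrite eqxx.
  by apply/esym; rewrite -(inj_eq enum_rank_inj) uj eq_sym neq_lift.
move=> a b; rewrite /= /star_edge !isSomeE.
have [->|av] := eqVneq a v; have [->|bv] := eqVneq b v => //=.
- by rewrite edge_irrefl.
- by rewrite dv.
- by rewrite edge_sym dv.
apply/esym/negP => ab; have := no_triangle (dv a av) ab.
by rewrite edge_sym dv.
Qed.

Lemma star_dominating (m : nat) :
  isomorphic T (star m) -> exists v : T, dominating v.
Proof.
case=> f [g fK gK] edgef; exists (g None) => u.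
rewrite -edgef gK; case fu: (f u) => [j|] //.
by rewrite -[u]fK fu eqxx.
Qed.

End Tree.

Import Order.TTheory GRing.Theory Num.Theory.
Local Open Scope ring_scope.

(** At order 2 the bound fails: the Wiener index is 1 and the right-hand side is 3/4. At order 1 the
    tree is a star but the bound is strict, 0 against 1/4. *)
Theorem theorem3p1 (n : nat) (T : sgraph) (T_tree : is_tree T)
    (T_order : #|T| = n) :
  (n <> 2%N ->
     (wiener T)%:R <= 1 / 4 * (2 * n%:R - 3) * (total_ecc T)%:R + 1 / 4 :> rat)
  /\
  ((3 <= n)%N ->
     ((wiener T)%:R = 1 / 4 * (2 * n%:R - 3) * (total_ecc T)%:R + 1 / 4 :> rat
      <-> isomorphic T (star n.-1))).
Proof.
subst n; have leW := wiener_le T_tree; split=> [n2|n3].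
  have := leq_trans leW (leq_add (leqnn _) (sum_ecc1_le T_tree n2)).
  by rewrite -(ler_nat rat) !natrD !natrM; lra.
split=> [eqW|isoT]; last first.
  have [v dv] := star_dominating isoT.
  have /(congr1 (fun k => k%:R : rat)) := dominating_wiener T_tree n3 dv.
  by rewrite !natrD !natrM; lra.
have [v /eqP v1|no1] := pickP (fun v : T => vertex_ecc v == 1%N).
  exact (dominating_star T_tree (ecc1_dominating T_tree v1)).
(* Without a vertex of eccentricity 1 the correction sum vanishes, so the Wiener index falls short
   of the claimed value by at least 1/4. *)
move: leW; rewrite [X in (_ <= _ + X)%N]big1 => [|v _]; last by rewrite no1.
by rewrite -(ler_nat rat) !natrD !natrM; lra.
Qed.
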